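(* Let $\mathcal{X}$ be a real linear space with $\dim\mathcal{X}=n$ and let $\mathcal{L}\subset\mathcal{X}\times\mathcal{X}^*$ be a Lagrangian subspace. Then $$\Sigma(\pi(v),\pi(w)):=\langle \pi^*(v)\mid\pi(w)\rangle,\qquad v,w\in\mathcal{L},$$ is a well-defined and symmetric bilinear form on $\pi(\mathcal{L})$. Furthermore, the symmetric map induced by $\Sigma$ can be extended to a symmetric map $$\widetilde{Q}=\begin{bmatrix} Q & M\\ M^T & 0\end{bmatrix}:\mathcal{X}\times\mathcal{M}\to\mathcal{X}^*\times\mathcal{M}^*,\qquad \mathcal{M}=\mathbb{R}^k,$$ with $Q=Q^T$ a real $n\times n$ matrix extending $\Sigma$ (i.e. $\Sigma(x,x')=x'^TQx$ for all $x,x'\in\pi(\mathcal{L})$) and $M$ a full-rank real $n\times k$ matrix with $\ker M^T=\pi(\mathcal{L})$, in such a way that $\mathcal{L}$ is given by $$\mathcal{L}=\{(x,e)\in\mathcal{X}\times\mathcal{X}^*\mid \exists \mu\in\mathcal{M} \text{ s.t. } e=Qx+M\mu,\; 0=M^Tx\}.$$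
   Context: $\mathcal{X}$ is a finite-dimensional real linear space with dual $\mathcal{X}^*$, and $\langle e\mid x\rangle$ denotes the duality product between $x\in\mathcal{X}$ and $e\in\mathcal{X}^*$. Elements of $\mathcal{X}$ and $\mathcal{X}^*$ are identified with column vectors in $\mathbb{R}^n$ by means of a basis of $\mathcal{X}$ and its dual basis, so that $\langle e\mid x\rangle=e^Tx$. The projections are $\pi:\mathcal{X}\times\mathcal{X}^*\to\mathcal{X}$, $\pi(x,e)=x$, and $\pi^*:\mathcal{X}\times\mathcal{X}^*\to\mathcal{X}^*$, $\pi^*(x,e)=e$. On $\mathcal{X}\times\mathcal{X}^*$ consider the bilinear form $$\langle (x_1,e_1),(x_2,e_2)\rangle_- := \langle e_1\mid x_2\rangle-\langle e_2\mid x_1\rangle.$$ A Lagrangian subspace is a subspace $\mathcal{L}\subset\mathcal{X}\times\mathcal{X}^*$ that equals its own orthogonal companion with respect to $\langle\cdot,\cdot\rangle_-$, i.e. $\mathcal{L}=\{v\in\mathcal{X}\times\mathcal{X}^*\mid \langle v,w\rangle_-=0 \text{ for all } w\in\mathcal{L}\}$. ''Well-defined'' means that the value of $\langle \pi^*(v)\mid\pi(w)\rangle$ depends on $v,w\in\mathcal{L}$ only through $\pi(v)$ and $\pi(w)$. Since $M$ has full rank and $\ker M^T=\pi(\mathcal{L})$, one has $k=n-\dim\pi(\mathcal{L})$ (and $\mathcal{M}$, $M$ are void if $k=0$). *)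

(* Defs.v *)
From mathcomp Require Import all_boot all_order all_algebra.
From mathcomp Require Import reals.

Set Implicit Arguments.
Unset Strict Implicit.
Unset Printing Implicit Defensive.

Import GRing.Theory.
Local Open Scope ring_scope.

Definition dual (R : realType) (X : vectType R) := 'Hom(X, R^o).

Definition duality (R : realType) (X : vectType R) (e : dual X) (x : X) : R :=
  e x.

Definition prX {R : realType} {X : vectType R} : 'Hom((X * dual X)%type, X) :=
  linfun fst.

Definition prD {R : realType} {X : vectType R} :
    'Hom((X * dual X)%type, dual X) :=
  linfun snd.

Lemma prXE (R : realType) (X : vectType R) (v : (X * dual X)%type) :
  prX v = v.1.
Proof. exact: lfunE. Qed.

Lemma prDE (R : realType) (X : vectType R) (v : (X * dual X)%type) :
  prD v = v.2.
Proof. exact: lfunE. Qed.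

Definition prX_im (R : realType) (X : vectType R)
    (L : {vspace (X * dual X)%type}) : {vspace X} :=
  (@prX R X @: L)%VS.

Definition minus_form (R : realType) (X : vectType R)
    (v w : (X * dual X)%type) : R :=
  duality (prD v) (prX w) - duality (prD w) (prX v).

Definition lagrangian (R : realType) (X : vectType R)
    (L : {vspace (X * dual X)%type}) : Prop :=
  forall v : (X * dual X)%type,
    v \in L <-> (forall w : (X * dual X)%type, w \in L -> minus_form v w = 0).

(* Only meaningful when [b] is a basis of [X]. *)
Definition dual_basis (R : realType) (X : vectType R) (n : nat)
    (b : n.-tuple X) : n.-tuple (dual X) :=
  [tuple linfun (coord b i : X -> R^o) | i < n].

(* Used both for X with a basis b, and for its dual with [dual_basis b]. *)
Definition colcoord (R : realType) (V : vectType R) (n : nat)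
    (b : n.-tuple V) (v : V) : 'cV[R]_n :=
  \col_(i < n) coord b i v.

Lemma dual_basisE (R : realType) (X : vectType R) (n : nat)
    (b : n.-tuple X) (i : 'I_n) (x : X) :
  (dual_basis b)`_i x = coord b i x.
Proof. by rewrite -tnth_nth tnth_mktuple lfunE. Qed.

Lemma dual_basis_is_basis (R : realType) (X : vectType R) (n : nat)
    (b : n.-tuple X) :
  basis_of fullv b -> basis_of fullv (dual_basis b).
Proof.
move=> b_basis; have b_free := basis_free b_basis.
have dimX : dim X = n by rewrite -dimvf -(size_basis b_basis).
have dfree : free (dual_basis b).
  apply/freeP => c c0 i.
  move/lfunP: c0 => /(_ b`_i); rewrite sum_lfunE zero_lfunE (bigD1 i) //=.
  rewrite big1 => [|j ji]; rewrite scale_lfunE dual_basisE.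
    by rewrite coord_free // eqxx addr0 => <-; rewrite [RHS]mulr1.
  by rewrite coord_free // eq_sym (negbTE ji) scaler0.
rewrite basisEfree dfree subvf size_tuple dimvf.
by rewrite /dim /= dimX muln1 leqnn.
Qed.

(* The identification <e | x> = e^T x. *)
Lemma duality_colcoord (R : realType) (X : vectType R) (n : nat)
    (b : n.-tuple X) (e : dual X) (x : X) :
  basis_of fullv b ->
  duality e x = ((colcoord (dual_basis b) e)^T *m colcoord b x) 0 0.
Proof.
move=> /dual_basis_is_basis db_basis.
rewrite mxE {1}(coord_basis db_basis (memvf e)) /duality sum_lfunE.
apply: eq_bigr => i _.
by rewrite scale_lfunE dual_basisE !mxE.
Qed.

(* Main.v *)
(* Over a point [x] of [pi(L)] the fibre of [L] is a coset of the annihilator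
   of [pi(L)]: by isotropy two covectors of the fibre agree on [pi(L)], and by
   maximality every covector vanishing on [pi(L)] lies over 0.  A linear
   section of [pi] on [L] therefore gives Sigma; precomposing both arguments
   with a projector onto [pi(L)] extends it to Q, and the columns of M are a
   basis of the annihilator. *)
Require Import Defs.
From HB Require Import structures.
From mathcomp Require Import all_boot all_order all_algebra.
From mathcomp Require Import reals.

Set Implicit Arguments.
Unset Strict Implicit.
Unset Printing Implicit Defensive.

Import GRing.Theory.
Local Open Scope ring_scope.

(** The columns of [M] are a basis of the kernel of [A]. The last clause is the double orthogonal:
    the row space of [A] lies in the kernel of [M^T], and the ranks agree. *)
Lemma orthogonal_complement_mx (F : fieldType) (d n : nat) (A : 'M[F]_(d, n)) :
  exists (k : nat) (M : 'M[F]_(n, k)),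
    [/\ \rank M = k, k = (n - \rank A)%N,
        forall c : 'cV_n, A *m c = 0 <-> exists mu, c = M *m mu &
        forall x : 'cV_n, M^T *m x = 0 <-> exists y, x = A^T *m y].
Proof.
pose K := kermx A^T; pose B := row_base K.
exists (\rank K), B^T.
have rB : \rank B = \rank K by rewrite eq_row_base.
have rK : \rank K = (n - \rank A)%N by rewrite mxrank_ker mxrank_tr.
have AB0 : B *m A^T = 0 by apply/sub_kermxP; rewrite eq_row_base.
have leA : (A <= kermx B^T)%MS.
  by apply/sub_kermxP; rewrite -[A]trmxK -trmx_mul AB0 trmx0.
(* An inclusion of row spaces is an equality once the ranks match: here
   [n - (n - \rank A) = \rank A]. *)
have eqA : (A == kermx B^T)%MS.
  rewrite -(geq_leqif (mxrank_leqif_eq leA)) mxrank_ker mxrank_tr rB rK.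
  by rewrite subKn // rank_leq_col.
split=> // [|c|x]; first by rewrite mxrank_tr.
- split=> [Ac0 | [mu ->]]; last first.
    by rewrite mulmxA -[A]trmxK -trmx_mul AB0 trmx0 mul0mx.
  have /submxP[mu cE] : (c^T <= B)%MS.
    by rewrite eq_row_base; apply/sub_kermxP; rewrite -trmx_mul Ac0 trmx0.
  by exists mu^T; rewrite -trmx_mul -cE trmxK.
- rewrite trmxK; split=> [Bx0 | [y ->]]; last by rewrite mulmxA AB0 mul0mx.
  have /submxP[y xE] : (x^T <= A)%MS.
    by rewrite (eqmxP eqA); apply/sub_kermxP; rewrite -trmx_mul Bx0 trmx0.
  by exists y^T; rewrite -trmx_mul -xE trmxK.
Qed.

(** * Coordinates in [b] and its dual basis, Gram matrices, annihilators *)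

Section Coordinates.
Variables (R : realType) (X : vectType R) (n : nat) (b : n.-tuple X).
Hypothesis b_basis : basis_of {: X} b.

Lemma colcoord_is_linear (V : vectType R) (m : nat) (c : m.-tuple V) :
  linear (colcoord c).
Proof. by move=> a u v; apply/colP=> i; rewrite !mxE linearP. Qed.

HB.instance Definition _ (V : vectType R) (m : nat) (c : m.-tuple V) :=
  GRing.isLinear.Build R V 'cV[R]_m _ (colcoord c) (colcoord_is_linear c).

Lemma colcoord_inj (V : vectType R) (m : nat) (c : m.-tuple V) :
  basis_of {: V} c -> injective (colcoord c).
Proof.
move=> c_basis u v /colP uv; rewrite (coord_basis c_basis (memvf u)).
rewrite (coord_basis c_basis (memvf v)); apply: eq_bigr => i _.
by have := uv i; rewrite !mxE => ->.
Qed.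

Lemma colcoord_dualE (e : dual X) (i : 'I_n) :
  colcoord (dual_basis b) e i 0 = e b`_i.
Proof.
have db := dual_basis_is_basis b_basis.
rewrite mxE {2}(coord_basis db (memvf e)) sum_lfunE (bigD1 i) //=.
rewrite big1 => [|j ji]; rewrite scale_lfunE dual_basisE.
  by rewrite coord_free ?(basis_free b_basis) // eqxx addr0 [RHS]mulr1.
rewrite coord_free ?(basis_free b_basis) // eq_sym (negbTE ji).
by rewrite scaler0.
Qed.

(** The column index goes with the argument of [f], so this is the matrix of [f] from [b] to the
    dual basis, acting on columns from the left. *)
Definition gram (f : 'Hom(X, dual X)) : 'M[R]_n :=
  \matrix_(i, j) f b`_j b`_i.

Lemma gram_colcoord (f : 'Hom(X, dual X)) (x : X) :
  gram f *m colcoord b x = colcoord (dual_basis b) (f x).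
Proof.
apply/colP=> i; rewrite colcoord_dualE {2}(coord_basis b_basis (memvf x)).
rewrite linear_sum sum_lfunE mxE; apply: eq_bigr => j _.
by rewrite linearZ scale_lfunE !mxE mulrC.
Qed.

Lemma gramE (f : 'Hom(X, dual X)) (x y : X) :
  f x y = ((colcoord b y)^T *m gram f *m colcoord b x) 0 0.
Proof.
rewrite -/(duality _ _) (duality_colcoord _ _ b_basis) -mulmxA gram_colcoord.
by rewrite -[in RHS](trmxK (colcoord _ (f x))) -trmx_mul [RHS]mxE.
Qed.

(** The orthogonal complement lemma is applied to the matrix [A] whose rows are the coordinates of a
    basis of [V]: the vectors [A^T *m y] run through [V], and [A] sends a covector to its values on
    that basis. *)
Lemma annihilator_mx (V : {vspace X}) :
  exists (k : nat) (M : 'M[R]_(n, k)),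
    [/\ \rank M = k, k = (n - \dim V)%N,
        forall x, M^T *m colcoord b x = 0 <-> x \in V &
        forall e : dual X, (exists mu, colcoord (dual_basis b) e = M *m mu)
          <-> forall x, x \in V -> e x = 0].
Proof.
pose A : 'M[R]_(\dim V, n) := \matrix_(i, j) coord b j (vbasis V)`_i.
have trA (y : 'cV_(\dim V)) :
    A^T *m y = colcoord b (\sum_i y i 0 *: (vbasis V)`_i).
  apply/colP=> j; rewrite linear_sum summxE mxE; apply: eq_bigr => i _.
  by rewrite linearZ !mxE mulrC.
have mulA (e : dual X) :
    A *m colcoord (dual_basis b) e = \col_i e (vbasis V)`_i.
  apply/colP=> i; rewrite [RHS]mxE.
  rewrite -/(duality _ _) (duality_colcoord _ _ b_basis) [LHS]mxE [RHS]mxE.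
  by apply: eq_bigr => j _; rewrite !mxE mulrC.
(* A vanishing combination of the rows is one of the basis vectors of [V], so the left kernel is
   zero. *)
have rA : \rank A = \dim V.
  apply/eqP; change (row_free A); rewrite -kermx_eq0; apply/rowV0P=> y.
  move=> /sub_kermxP/(congr1 trmx).
  rewrite trmx_mul trA trmx0 -(linear0 (colcoord b : {linear X -> 'cV_n})).
  move=> /(colcoord_inj b_basis) y0.
  apply/rowP=> i; rewrite [RHS]mxE.
  have /freeP/(_ _ y0 i) := basis_free (vbasisP V).
  by rewrite mxE.
have [k [M [rM kE annM kerM]]] := orthogonal_complement_mx A.
exists k, M; split=> //; first by rewrite -rA.
- move=> x; rewrite kerM; split=> [[y] | xV].
    rewrite trA => /(colcoord_inj b_basis) ->.
    apply: memv_suml => i _; rewrite memvZ // vbasis_mem //.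
    by rewrite mem_nth ?size_tuple.
  exists (\col_i coord (vbasis V) i x); rewrite trA; congr (colcoord b _).
  by rewrite {1}(coord_vbasis xV); apply: eq_bigr => i _; rewrite mxE.
- move=> e; rewrite -annM mulA; split=> [/colP e0 x xV | e0].
    rewrite (coord_vbasis xV) linear_sum big1 // => i _.
    by have := e0 i; rewrite linearZ /= !mxE => ->; rewrite scaler0.
  by apply/colP=> i; rewrite !mxE e0 // vbasis_mem // mem_nth ?size_tuple.
Qed.

End Coordinates.

(** * The form on [prX_im L], its extension, and the fibres of [L] *)

Section Lagrangian.
Variables (R : realType) (X : vectType R) (L : {vspace (X * dual X)%type}).

(** A section of [prX] over [prX_im L]: [^-1] inverts on the image, and the outer projector forces
    values into [L] even for arguments outside [prX_im L]. *)
Definition lift : 'Hom(X, (X * dual X)%type) :=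
  (projv L \o (prX \o projv L)^-1)%VF.

Lemma lift_mem (x : X) : lift x \in L.
Proof. by rewrite comp_lfunE memv_proj. Qed.

Lemma liftK (x : X) : x \in prX_im L -> prX (lift x) = x.
Proof.
move=> xV; rewrite comp_lfunE -(comp_lfunE prX) limg_lfunVK //.
by rewrite limg_comp limg_proj.
Qed.

Lemma prX_mem (v : (X * dual X)%type) : v \in L -> prX v \in prX_im L.
Proof. exact: memv_img. Qed.

Definition sigma (x y : subvs_of (prX_im L)) : R :=
  duality (prD (lift (vsval x))) (vsval y).

Lemma sigma_is_bilinear :
  bilinear_for (GRing.Scale.Law.clone _ _ *%R _)
               (GRing.Scale.Law.clone _ _ *%R _) sigma.
Proof.
split=> [y a x x' | x a y y']; rewrite /sigma /duality !linearP //.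
by rewrite add_lfunE scale_lfunE.
Qed.

HB.instance Definition _ := bilinear_isBilinear.Build R
  (subvs_of (prX_im L)) (subvs_of (prX_im L)) R *%R *%R sigma sigma_is_bilinear.

(** Projecting the first argument alone would already extend [sigma]; projecting both keeps the
    extension symmetric on all of [X]. *)
Definition sigma_ext_fun (x : X) : dual X :=
  (prD (lift (projv (prX_im L) x)) \o projv (prX_im L))%VF.

Lemma sigma_ext_fun_is_linear : linear sigma_ext_fun.
Proof.
by move=> a x y; rewrite /sigma_ext_fun !linearP comp_lfunDl comp_lfunZl.
Qed.

HB.instance Definition _ :=
  GRing.isLinear.Build R X (dual X) _ sigma_ext_fun sigma_ext_fun_is_linear.

Definition sigma_ext : 'Hom(X, dual X) := linfun sigma_ext_fun.

Lemma sigma_extE (x y : X) :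
  sigma_ext x y
    = duality (prD (lift (projv (prX_im L) x))) (projv (prX_im L) y).
Proof. by rewrite lfunE /= comp_lfunE. Qed.

Hypothesis L_lagrangian : lagrangian L.

Lemma lagrangian_sym (v w : (X * dual X)%type) :
  v \in L -> w \in L -> duality (prD v) (prX w) = duality (prD w) (prX v).
Proof. by move=> /L_lagrangian vL /vL /subr0_eq. Qed.

(** Write [y] as [prX w] with [w] in [L]. Symmetry turns the pairing into one that reads [v] only
    through [prX v]; symmetry again leads back to [v']. *)
Lemma lagrangian_duality_eq (v v' : (X * dual X)%type) (y : X) :
  v \in L -> v' \in L -> prX v = prX v' -> y \in prX_im L ->
  duality (prD v) y = duality (prD v') y.
Proof.
move=> vL v'L vv' /memv_imgP[w wL ->].
by rewrite lagrangian_sym // vv' lagrangian_sym.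
Qed.

Lemma sigmaE (v w : (X * dual X)%type) (x y : subvs_of (prX_im L)) :
  v \in L -> w \in L -> vsval x = prX v -> vsval y = prX w ->
  sigma x y = duality (prD v) (prX w).
Proof.
move=> vL wL xv yw; rewrite /sigma yw; apply: lagrangian_duality_eq => //.
- exact: lift_mem.
- by rewrite liftK ?subvsP.
- exact: prX_mem.
Qed.

Lemma lift_sym (x y : X) : x \in prX_im L -> y \in prX_im L ->
  duality (prD (lift x)) y = duality (prD (lift y)) x.
Proof.
move=> xV yV; rewrite -{1}(liftK yV) -{2}(liftK xV).
by rewrite lagrangian_sym ?lift_mem.
Qed.

(** The forward direction is isotropy, comparing [(x, e)] with [lift L x]; the converse is
    maximality. *)
Lemma lagrangian_fibre (x : X) (e : dual X) :
  (x, e) \in L <->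
  x \in prX_im L /\ forall y, y \in prX_im L -> (e - sigma_ext x) y = 0.
Proof.
have extE z y : z \in prX_im L -> y \in prX_im L ->
    sigma_ext z y = duality (prD (lift z)) y.
  by move=> zV yV; rewrite sigma_extE !projv_id.
split=> [xeL | [xV e0]].
  have xV : x \in prX_im L by have := prX_mem xeL; rewrite prXE.
  split=> // y yV; rewrite add_lfunE opp_lfunE extE //; apply/eqP.
  rewrite subr_eq0; apply/eqP.
  have := lagrangian_duality_eq xeL (lift_mem x) _ yV.
  by rewrite liftK // prXE prDE; apply.
apply/L_lagrangian=> w wL; rewrite /minus_form (prXE (x, e)) (prDE (x, e)) /=.
have wV := prX_mem wL.
apply/eqP; rewrite subr_eq0; apply/eqP.
(* On [prX w] the covector [e] agrees with that of [lift L x], which lies in [L] and so pairs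
   symmetrically with [w]. *)
have := e0 _ wV; rewrite add_lfunE opp_lfunE extE // => /subr0_eq ewE.
by rewrite [LHS]ewE (lagrangian_sym (lift_mem x) wL) liftK.
Qed.

End Lagrangian.

Theorem proposition5p3 (R : realType) (n : nat) (X : vectType R)
    (dimX : \dim {: X} = n) (b : n.-tuple X) (b_basis : basis_of {: X} b)
    (L : {vspace (X * dual X)%type}) (L_lagrangian : lagrangian L) :
  (forall v v' w w' : (X * dual X)%type,
     v \in L -> v' \in L -> w \in L -> w' \in L ->
     prX v = prX v' -> prX w = prX w' ->
     duality (prD v) (prX w) = duality (prD v') (prX w')) /\
  exists Sigma : {biscalar (subvs_of (prX_im L))},
    [/\ forall (v w : (X * dual X)%type) (x x' : subvs_of (prX_im L)),
          v \in L -> w \in L -> vsval x = prX v -> vsval x' = prX w ->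
          Sigma x x' = duality (prD v) (prX w),
        forall x x' : subvs_of (prX_im L), Sigma x x' = Sigma x' x &
        exists (k : nat) (Q : 'M[R]_n) (M : 'M[R]_(n, k))
          (Qt : 'M[R]_(n + k)),
          [/\ Qt = block_mx Q M M^T 0,
              Qt^T = Qt,
              Q^T = Q,
              forall x x' : subvs_of (prX_im L),
                Sigma x x' =
                ((colcoord b (vsval x'))^T *m Q *m colcoord b (vsval x)) 0 0 &
              [/\ \rank M = k,
                  k = (n - \dim (prX_im L))%N,
                  forall x : X,
                    M^T *m colcoord b x = 0 <-> x \in prX_im L &
                  forall (x : X) (e : dual X),
                    (x, e) \in L <->
                    exists mu : 'cV[R]_k,
                      colcoord (dual_basis b) e
                        = Q *m colcoord b x + M *m mu
                      /\ 0 = M^T *m colcoord b x]]].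
Proof.
split=> [v v' w w' vL v'L wL w'L vv' ww'|].
  (* The pairing reads its second argument only through [prX], so only the change from [v] to [v']
     needs an argument. *)
  by rewrite -ww'; apply: lagrangian_duality_eq => //; apply: prX_mem.
have [k [M [rM kE kerM annM]]] := annihilator_mx b_basis (prX_im L).
pose Q := gram b (sigma_ext L).
have Qsym : Q^T = Q.
  (* Both basis vectors get projected into [prX_im L], where the pairing through [lift] is
     symmetric. *)
  apply/matrixP=> i j; rewrite !mxE !sigma_extE.
  by rewrite lift_sym ?memv_proj.
exists (@sigma R X L : {biscalar _}); split=> [v w x y|x y|].
- exact: sigmaE.
- by rewrite [LHS]lift_sym ?subvsP.
exists k, Q, M, (block_mx Q M M^T 0); split=> // [|x y|].
- by rewrite tr_block_mx Qsym trmxK trmx0.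
- by rewrite -(gramE b_basis) sigma_extE !projv_id ?subvsP.
(* The fibre condition says that [e - sigma_ext L x] annihilates [prX_im L]; in coordinates,
   [e - Q x] is then some [M *m mu]. *)
split=> // x e; rewrite (lagrangian_fibre L_lagrangian) -annM.
split=> [[/kerM Mx [mu eE]] | [mu [eE Mx]]].
  exists mu; rewrite -eE Mx (gram_colcoord b_basis) -linearD.
  by rewrite addrC subrK.
split; first exact/kerM.
by exists mu; rewrite linearB /= eE (gram_colcoord b_basis) addrC addKr.
Qed.
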